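(* Let $1\le n<m$ and let $A=(a_{ij})_{m\times m}$ be a right-quantum matrix, i.e. $a_{jk}a_{ik}=a_{ik}a_{jk}$ for all $i\neq j$ and all $k$, and $a_{ik}a_{jl}-a_{jk}a_{il}=a_{jl}a_{ik}-a_{il}a_{jk}$ for all $i\neq j$, $k\neq l$. For $n<i,j\le m$ let $$c_{ij}=-\det{}^{-1}(I-A_0)\cdot\det\begin{pmatrix} I-A_0 & -a_{*j}\\ -a_{i*} & -a_{ij}\end{pmatrix},\qquad C=(c_{ij})_{n+1\le i,j\le m}.$$ Then $\det{}^{-1}(I-A_0)\cdot\det(I-A)=\det(I-C)$.
   Context: $\mathcal A$ is the $\mathbb C$-algebra of formal power series in non-commuting variables $a_{ij}$, $1\le i,j\le m$; identities are taken in the quotient of $\mathcal A$ by the closed two-sided ideal generated by the right-quantum relations. $A_0=(a_{ij})_{1\le i,j\le n}$, $a_{i*}=(a_{i1},\dots,a_{in})$, $a_{*j}=(a_{1j},\dots,a_{nj})^T$. For a square matrix $B=(b_{rs})_{N\times N}$ with entries in $\mathcal A$, $\det B=\sum_{\sigma\in S_N}(-1)^{\operatorname{inv}\sigma}b_{\sigma(1)1}\cdots b_{\sigma(N)N}$. $\det^{-1}(I-A_0)$ is the inverse of $\det(I-A_0)$ (which has constant term $1$). $\det(I-C)$ is computed by the same formula with the $c_{ij}$ as entries. *)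

(* Defs.v *)
From HB Require Import structures.
From mathcomp Require Import all_boot all_order all_algebra all_fingroup.
From mathcomp Require Import boolp classical_sets functions.

Set Implicit Arguments.
Unset Strict Implicit.
Unset Printing Implicit Defensive.

Import GRing.Theory.
Local Open Scope ring_scope.

(** Formal power series in non-commuting variables indexed by [X]: a series
    is the function mapping each word to its coefficient. *)
Definition ncseries (K : nzRingType) (X : eqType) : Type := seq X -> K.

Section NCSeries.
Variables (K : nzRingType) (X : eqType).
Local Notation A := (ncseries K X).
Implicit Types (f g h : A) (w : seq X).

HB.instance Definition _ := GRing.Zmodule.copy A (seq X -> K).

Definition ncs_one : A := fun w => (nilp w)%:R.

Definition ncs_mul f g : A :=
  fun w => \sum_(i < (size w).+1) f (take i w) * g (drop i w).

Let ncs_shift x f : A := fun w => f (x :: w).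

Let ncs_mul_nil f g : ncs_mul f g [::] = f [::] * g [::].
Proof. by rewrite /ncs_mul big_ord_recl big_ord0 addr0. Qed.

Let ncs_mul_cons f g x w :
  ncs_mul f g (x :: w) = f [::] * g (x :: w) + ncs_mul (ncs_shift x f) g w.
Proof. by rewrite /ncs_mul big_ord_recl. Qed.

Let ncs_addE f g w : (f + g) w = f w + g w.
Proof. by []. Qed.

Fact ncs_mul1l : left_id ncs_one ncs_mul.
Proof.
move=> f; apply/funext => w; rewrite /ncs_mul big_ord_recl take0 drop0 mul1r.
rewrite big1 ?addr0// => i _.
by case: w i => [|x w] [i lt_i] //=; rewrite /ncs_one /= mul0r.
Qed.

Fact ncs_mul1r : right_id ncs_one ncs_mul.
Proof.
move=> f; apply/funext => w; rewrite /ncs_mul big_ord_recr /= take_size.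
rewrite drop_size mulr1 big1 ?add0r// => i _.
by rewrite /ncs_one /nilp size_drop subn_eq0 leqNgt ltn_ord mulr0.
Qed.

Fact ncs_mulDl : left_distributive ncs_mul +%R.
Proof.
move=> f g h; apply/funext => w; rewrite ncs_addE /ncs_mul -big_split /=.
by apply: eq_bigr => i _; rewrite ncs_addE mulrDl.
Qed.

Fact ncs_mulDr : right_distributive ncs_mul +%R.
Proof.
move=> f g h; apply/funext => w; rewrite ncs_addE /ncs_mul -big_split /=.
by apply: eq_bigr => i _; rewrite ncs_addE mulrDr.
Qed.

Fact ncs_mulA : associative ncs_mul.
Proof.
move=> f g h; apply/funext => w.
elim: w f g h => [|x w IHw] f g h; first by rewrite !ncs_mul_nil mulrA.
rewrite !ncs_mul_cons IHw ncs_mul_nil mulrDr !mulrA -addrA; congr (_ + _).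
have -> : ncs_shift x (ncs_mul f g) =
    (fun u => f [::] * ncs_shift x g u) + ncs_mul (ncs_shift x f) g.
  by apply/funext => u; rewrite /ncs_shift ncs_mul_cons.
rewrite ncs_mulDl ncs_addE; congr (_ + _).
by rewrite /ncs_mul mulr_sumr; apply: eq_bigr => i _; rewrite mulrA.
Qed.

Fact ncs_one_neq0 : ncs_one != 0.
Proof.
by apply/eqP => /(congr1 (fun f : A => f [::])); apply/eqP/oner_neq0.
Qed.

HB.instance Definition _ := GRing.Zmodule_isNzRing.Build A
  ncs_mulA ncs_mul1l ncs_mul1r ncs_mulDl ncs_mulDr ncs_one_neq0.

Lemma ncs_mulE f g w :
  (f * g) w = \sum_(i < (size w).+1) f (take i w) * g (drop i w).
Proof. by []. Qed.

Lemma ncs_oneE w : (1 : A) w = (nilp w)%:R.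
Proof. by []. Qed.

Definition ncs_unit : pred A := fun f => `[< exists g, g * f = 1 /\ f * g = 1 >].

Definition ncs_inv f : A :=
  if pselect (exists g, g * f = 1 /\ f * g = 1) is left e then sval (cid e)
  else f.

Fact ncs_mulVf : {in ncs_unit, left_inverse 1 ncs_inv *%R}.
Proof.
by move=> f /asboolP uf; rewrite /ncs_inv; case: pselect => // e; case: cid => g [].
Qed.

Fact ncs_mulfV : {in ncs_unit, right_inverse 1 ncs_inv *%R}.
Proof.
by move=> f /asboolP uf; rewrite /ncs_inv; case: pselect => // e; case: cid => g [].
Qed.

Fact ncs_unitP f g : g * f = 1 /\ f * g = 1 -> ncs_unit f.
Proof. by move=> fg; apply/asboolP; exists g. Qed.

Fact ncs_inv_out : {in [predC ncs_unit], ncs_inv =1 id}.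
Proof. by move=> f /asboolPn uf; rewrite /ncs_inv; case: pselect. Qed.

HB.instance Definition _ := GRing.NzRing_hasMulInverse.Build A
  ncs_mulVf ncs_mulfV ncs_unitP ncs_inv_out.

Let ncs_exp_small f k w : f [::] = 0 -> (size w < k)%N -> (f ^+ k) w = 0.
Proof.
move=> f0; elim: k w => // k IHk w lt_wk; rewrite exprS ncs_mulE.
rewrite big_ord_recl take0 f0 mul0r add0r big1 // => i _.
rewrite IHk ?mulr0// size_drop lift0 (leq_trans _ (_ : size w <= k)%N)//.
by rewrite ltn_subrL /= (leq_ltn_trans (leq0n i)).
Qed.

(** A series with constant term 1 is invertible, by the geometric series. *)
Lemma ncs_unit1 f : f [::] = 1 -> f \is a GRing.unit.
Proof.
move=> f1; pose h : A := 1 - f.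
have h0 : h [::] = 0 by rewrite /h -[LHS]/(1 - f [::]) f1 subrr.
have fE : f = 1 - h by rewrite /h opprB addrC subrK.
clearbody h.
pose S k : A := \sum_(j < k) h ^+ j.
pose g : A := fun w => S (size w).+1 w.
have gS k w : (size w < k)%N -> g w = S k w.
  elim: k => // k IHk; rewrite ltnS leq_eqVlt => /predU1P[<-//|lt_wk].
  rewrite IHk// /S big_ord_recr /= -[RHS]/(_ w + (h ^+ k) w).
  by rewrite ncs_exp_small// addr0.
have fS k : f * S k = 1 - h ^+ k.
  by rewrite fE -(opprB (h ^+ k)) subrX1 -mulNr opprB.
have Sf k : S k * f = 1 - h ^+ k.
  rewrite -fS fE mulrBl mulrBr mul1r mulr1 mulr_suml mulr_sumr.
  by congr (_ - _); apply: eq_bigr => j _; rewrite -exprSr exprS.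
apply/unitrP; exists g; split; apply/funext => w.
- transitivity ((S (size w).+1 * f) w).
    rewrite !ncs_mulE; apply: eq_bigr => i _; congr (_ * _).
    by apply: gS; rewrite ltnS size_take_min geq_minr.
  by rewrite Sf -[LHS]/(_ w - (h ^+ _) w) ncs_exp_small// subr0.
- transitivity ((f * S (size w).+1) w).
    rewrite !ncs_mulE; apply: eq_bigr => i _; congr (_ * _).
    by apply: gS; rewrite ltnS size_drop leq_subr.
  by rewrite fS -[LHS]/(_ w - (h ^+ _) w) ncs_exp_small// subr0.
Qed.

Definition ncs_var (x : X) : A := fun w => (w == [:: x])%:R.

Definition two_sided_ideal (I : set A) : Prop :=
  [/\ I 0, (forall f g, I f -> I g -> I (f - g)),
      (forall f g, I g -> I (f * g)) & (forall f g, I f -> I (f * g))].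

(** Closed for the topology in which a neighbourhood basis of [f] is given by
    the sets of series agreeing with [f] on all words of length at most [d]. *)
Definition ncs_closed (I : set A) : Prop :=
  forall f, (forall d : nat, exists2 g, I g &
    forall w, (size w <= d)%N -> g w = f w) -> I f.

Definition closed_ideal_gen (G : set A) : set A :=
  fun f => forall I : set A,
    two_sided_ideal I -> ncs_closed I -> (forall g, G g -> I g) -> I f.

End NCSeries.

(** Determinant over a non-commutative ring, with the factors of each product
    in the order of the columns: MathComp's [\det] orders them by rows. *)
Definition inv_num (N : nat) (s : 'S_N) : nat :=
  #|[set p : 'I_N * 'I_N | (p.1 < p.2)%N && (s p.2 < s p.1)%N]|.

Definition cdet (R : nzRingType) (N : nat) (B : 'M[R]_N) : R :=
  \sum_(s : 'S_N) (-1) ^+ inv_num s * \prod_(j < N) B (s j) j.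

Section RightQuantum.
Variables (K : nzRingType) (m : nat).
Local Notation A := (ncseries K ('I_m * 'I_m)%type).

Definition ncs_generic : 'M[A]_m := \matrix_(i, j) ncs_var K (i, j).

Local Notation a := (fun i j => ncs_generic i j).

Inductive rq_relator : set A :=
| RqColumn i j k of i != j :
    rq_relator (a j k * a i k - a i k * a j k)
| RqCross i j k l of i != j & k != l :
    rq_relator ((a i k * a j l - a j k * a i l) -
                (a j l * a i k - a i l * a j k)).

Definition rq_eq (f g : A) : Prop := closed_ideal_gen rq_relator (f - g).

End RightQuantum.

(** The index set {1, ..., m} is split as {1, ..., n} followed by
    {n+1, ..., m} with m = n + p, so that [A] is a block matrix with upper left
    block [A_0]. *)
Section SchurMatrix.
Variables (R : unitRingType) (n p : nat) (A : 'M[R]_(n + p)).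

Definition schur_entry (i j : 'I_p) : R :=
  - (cdet (1%:M - ulsubmx A))^-1 *
    cdet (block_mx (1%:M - ulsubmx A)        (- col j (ursubmx A))
                   (- row i (dlsubmx A)) (- (drsubmx A i j)%:M : 'M_1)).

Definition schur_mx : 'M[R]_p := \matrix_(i, j) schur_entry i j.

End SchurMatrix.

(* Main.v *)
(* The right-quantum relations only involve commutators, so [I - A] and the
   matrices defining [C] satisfy them as well. For a right-quantum matrix,
   exchanging two adjacent columns changes the sign of the column determinant,
   so subtracting from a column right multiples of earlier ones does not change
   it. Clearing the upper right block of [I - A] in this way gives the Schur
   complement formula [det (I - A) = det (I - A_0) det S], with
   [S = I - D - C' (I - A_0)^-1 B] for [A = [[A_0, B], [C', D]]]; the same
   formula with a 1 x 1 lower right block identifies [S] with [I - C]. All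
   congruences hold modulo any two-sided ideal containing the relators. *)
Require Import Defs.
From HB Require Import structures.
From mathcomp Require Import all_boot all_order all_algebra all_fingroup.
From mathcomp Require Import boolp classical_sets functions reals complex.
Import GRing.Theory Num.Theory.
Local Open Scope ring_scope.
Local Open Scope complex_scope.

Set Implicit Arguments.
Unset Strict Implicit.
Unset Printing Implicit Defensive.

(** * Signs of permutations and the column determinant *)

Lemma index_enum_split N (q : 'I_N) : exists s1 s2,
  [/\ index_enum 'I_N = s1 ++ q :: s2, q \notin s1 & q \notin s2].
Proof.
have := index_enum_uniq 'I_N; case/splitPr: (mem_index_enum q) => s1 s2.
by rewrite cat_uniq /= negb_or => /and3P[_ /andP[q1 _] /andP[q2 _]]; exists s1, s2.
Qed.

(* Both sides are the sign of the Vandermonde determinant of [0, ..., N - 1]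
   after permuting its columns by [s]. *)
Lemma odd_inv_num N (s : 'S_N) : odd (inv_num s) = s.
Proof.
pose D (t : 'S_N) : int := \prod_(i < N) \prod_(j < N | (i < j)%N)
  ((t j : nat)%:Z - (t i : nat)%:Z).
have DE t : D t = (-1) ^+ t * D 1%g.
  have detD u : D u = \det (Vandermonde N (\row_i (u i : nat)%:Z)).
    by rewrite det_Vandermonde; do 2!apply: eq_bigr => ? _; rewrite !mxE.
  have -> : D t = \det (col_perm t (Vandermonde N (\row_i (i : nat)%:Z))).
    by rewrite detD; congr (\det _); apply/matrixP => i j; rewrite !mxE.
  rewrite col_permE det_mulmx det_perm odd_permV mulrC; congr (_ * _).
  by rewrite detD; congr (\det _); apply/matrixP => i j; rewrite !mxE perm1.
have D0 : D 1%g > 0.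
  by apply: prodr_gt0 => i _; apply: prodr_gt0 => j lt_ij; rewrite !perm1 subr_gt0.
have sgD : sgz (D s) = (-1) ^+ inv_num s.
  rewrite /D (big_morph (@sgz _) (@sgzM _) (sgz1 _)).
  under eq_bigr do rewrite (big_morph (@sgz _) (@sgzM _) (sgz1 _)).
  rewrite pair_big_dep /= (bigID (fun p : 'I_N * 'I_N => (s p.2 < s p.1)%N)) /=.
  rewrite [X in _ * X]big1 ?mulr1 => [|p /andP[lt_p]].
    rewrite /inv_num -prodr_const; apply: eq_big => [p|p /andP[_ lt_sp]].
      by rewrite inE.
    by rewrite ltr0_sgz// subr_lt0.
  rewrite -leqNgt leq_eqVlt => /orP[/eqP/ord_inj/perm_inj eq_p|lt_sp].
    by rewrite eq_p ltnn in lt_p.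
  by rewrite gtr0_sgz// subr_gt0.
move: sgD; rewrite DE sgzM (gtr0_sgz D0) mulr1 -[in RHS]signr_odd.
by case: (s : bool) (odd _) => [] [].
Qed.

Lemma cdetE (R : nzRingType) N (B : 'M[R]_N) :
  cdet B = \sum_(s : 'S_N) (-1) ^+ s * \prod_j B (s j) j.
Proof. by apply: eq_bigr => s _; rewrite -signr_odd odd_inv_num. Qed.

(** * Block permutations and block triangular column determinants *)

Definition perm_block_fun n p (s1 : 'S_n) (s2 : 'S_p) (i : 'I_(n + p)) : 'I_(n + p) :=
  match fintype.split i with inl a => lshift p (s1 a) | inr b => rshift n (s2 b) end.

Lemma perm_block_inj n p (s1 : 'S_n) (s2 : 'S_p) : injective (perm_block_fun s1 s2).
Proof.
have eqF a b : (lshift p a = rshift n b) -> False.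
  by move/eqP; rewrite eq_lrshift.
move=> i j; rewrite /perm_block_fun.
case: split_ordP => a ->; case: split_ordP => b ->.
- by move/lshift_inj/perm_inj ->.
- by move/eqF.
- by move/esym/eqF.
- by move/rshift_inj/perm_inj ->.
Qed.

Definition perm_block n p (s1 : 'S_n) (s2 : 'S_p) := perm (@perm_block_inj n p s1 s2).

Lemma perm_block_lshift n p (s1 : 'S_n) (s2 : 'S_p) i :
  perm_block s1 s2 (lshift p i) = lshift p (s1 i).
Proof. by rewrite permE /perm_block_fun (unsplitK (inl _)). Qed.

Lemma perm_block_rshift n p (s1 : 'S_n) (s2 : 'S_p) i :
  perm_block s1 s2 (rshift n i) = rshift n (s2 i).
Proof. by rewrite permE /perm_block_fun (unsplitK (inr _)). Qed.

(** The permutation matrix is block diagonal, so its integer determinant, which is the sign, is the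
    product of the two signs. *)
Lemma odd_perm_block n p (s1 : 'S_n) (s2 : 'S_p) :
  odd_perm (perm_block s1 s2) = s1 (+) s2.
Proof.
have : \det (perm_mx (perm_block s1 s2)) = (-1) ^+ s1 * (-1) ^+ s2 :> int.
  rewrite -!det_perm -(det_ublock _ 0); congr (\det _).
  apply/matrixP => i j; rewrite !mxE.
  case: split_ordP => a ->; rewrite !mxE; case: split_ordP => b ->; rewrite !mxE;
    by rewrite ?perm_block_lshift ?perm_block_rshift ?eq_lshift ?eq_rshift
      ?eq_lrshift ?eq_rlshift.
by rewrite det_perm; case: (odd_perm _) (odd_perm s1) (odd_perm s2) => [] [] [].
Qed.

(** An injection of a finite type into itself is onto: the images of the last [p] indices exhaust
    the last [p], so the first [n] must stay among the first [n]. *)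
Lemma perm_blockP n p (s : 'S_(n + p)) :
    (forall j, exists k, s (rshift n j) = rshift n k) ->
  exists s1 s2, s = perm_block s1 s2.
Proof.
move=> /fin_all_exists[f2 f2E].
have f2_inj : injective f2.
  by move=> i j f2ij; apply/rshift_inj/(@perm_inj _ s); rewrite !f2E f2ij.
have /fin_all_exists[f1 f1E] j : exists k, s (lshift p j) = lshift p k.
  case: (split_ordP (s (lshift p j))) => [k ->|k]; first by exists k.
  have [b ->] : exists b, k = f2 b.
    by exists (invF f2_inj k); rewrite f_invF.
  by rewrite -f2E => /perm_inj/eqP; rewrite eq_lrshift.
have f1_inj : injective f1.
  by move=> i j f1ij; apply/lshift_inj/(@perm_inj _ s); rewrite !f1E f1ij.
exists (perm f1_inj), (perm f2_inj); apply/permP => i.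
by case: (split_ordP i) => j ->;
  rewrite ?perm_block_lshift ?perm_block_rshift permE.
Qed.

(** Only block permutations contribute, since any other one picks an entry of the zero block. The
    left columns come first in each product, so the terms factor without commuting any entries. *)
Lemma cdet_lblock (R : nzRingType) n p (Aul : 'M[R]_n) Adl (Adr : 'M[R]_p) :
  cdet (block_mx Aul 0 Adl Adr) = cdet Aul * cdet Adr.
Proof.
rewrite !cdetE; set B := block_mx _ _ _ _.
pose h (u : 'S_n * 'S_p) := perm_block u.1 u.2.
have h_inj : injective h.
  move=> [s1 s2] [t1 t2] /permP eq_h; congr (_, _); apply/permP => i.
    by have := eq_h (lshift p i); rewrite !perm_block_lshift => /lshift_inj.
  by have := eq_h (rshift n i); rewrite !perm_block_rshift => /rshift_inj.
rewrite (bigID (mem [set h u | u in {: 'S_n * 'S_p}])) /= [X in _ + X]big1 ?addr0 => [|s].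
  rewrite (big_imset _ (in2W h_inj)) /=.
  rewrite mulr_suml -(pair_bigA _ (fun s1 s2 => (-1) ^+ h (s1, s2) *
     \prod_j B (h (s1, s2) j) j)) /=.
  apply: eq_bigr => s1 _; rewrite mulr_sumr; apply: eq_bigr => s2 _.
  rewrite /h/= odd_perm_block signr_addb big_split_ord /= -!mulrA.
  congr (_ * _); rewrite !mulrA commr_sign; congr (_ * _ * _);
    by apply: eq_bigr => j _; rewrite ?perm_block_lshift ?perm_block_rshift
      ?block_mxEul ?block_mxEdr.
move=> s_nblock.
have [j sj] : exists j, forall k, s (rshift n j) != rshift n k.
  apply/not_existsP => noj; move/imsetP: s_nblock; apply.
  have [j|s1 [s2 ->]] := @perm_blockP _ _ s; last by exists (s1, s2).
  by have /existsNP[k /negP] := noj j; rewrite negbK => /eqP; exists k.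
have /= [s1 [s2 [-> _ _]]] := index_enum_split (rshift n j).
rewrite big_cat big_cons /=; have [k ->|k /eqP] := split_ordP (s (rshift n j)).
  by rewrite block_mxEur mxE mul0r !mulr0.
by rewrite (negPf (sj k)).
Qed.

(** * Column operations on determinants modulo a two-sided ideal *)

Section ModuloIdeal.
Variables (R : nzRingType) (I : set R).
Hypotheses (ideal0 : I 0) (idealB : forall x y, I x -> I y -> I (x - y)).
Hypotheses (idealMl : forall x y, I y -> I (x * y)).
Hypotheses (idealMr : forall x y, I x -> I (x * y)).

Local Notation "x ~ y" := (I (x - y)) (at level 70).

Let idealN x : I x -> I (- x).
Proof. by move=> Ix; rewrite -sub0r; apply: idealB. Qed.

Let idealD x y : I x -> I y -> I (x + y).
Proof. by move=> Ix Iy; rewrite -[y]opprK; apply/idealB/idealN. Qed.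

Let ideal_sum (J : finType) (P : pred J) (F : J -> R) :
  (forall j, P j -> I (F j)) -> I (\sum_(j | P j) F j).
Proof. by move=> IF; apply: (big_ind I) => //; apply: idealD. Qed.

Let congrM x y x' y' : x ~ x' -> y ~ y' -> x * y ~ x' * y'.
Proof.
move=> xx' yy'; rewrite -(subrK (x' * y) (x * y)) -mulrBl -addrA -mulrBr.
by apply: idealD; [apply: idealMr | apply: idealMl].
Qed.

Let congr_trans y x z : x ~ y -> y ~ z -> x ~ z.
Proof. by move=> xy yz; rewrite -(subrK y x) -addrA; apply: idealD. Qed.

Lemma cdet_congr N (B C : 'M[R]_N) :
  (forall i j, B i j ~ C i j) -> cdet B ~ cdet C.
Proof.
move=> BC; rewrite /cdet -sumrB; apply: ideal_sum => s _; rewrite -mulrBr.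
apply: idealMl; apply: (big_ind2 (fun x y => x ~ y)) => //; first by rewrite subrr.
by move=> *; apply: congrM.
Qed.

(** Each even [s] is paired with the odd [tperm j k * s], and the two terms cancel modulo [I]. *)
Lemma alternating_sum_ideal N (j k : 'I_N) (F : 'S_N -> R) : j != k ->
    (forall s, F (tperm j k * s)%g ~ F s) ->
  I (\sum_(s : 'S_N) (-1) ^+ s * F s).
Proof.
move=> neq_jk Fsym; rewrite (bigID (@odd_perm _)) /= addrC.
rewrite [X in _ + X](reindex_inj (mulgI (tperm j k))) /=.
under [X in _ + X]eq_bigl do rewrite odd_permM odd_tperm neq_jk addTb.
rewrite -big_split; apply: ideal_sum => s even_s /=.
rewrite odd_permM odd_tperm neq_jk (negPf even_s) expr0 expr1 mul1r mulN1r.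
by rewrite -opprB; apply/idealN.
Qed.

Lemma index_enum_split2 N (j k : 'I_N) : k = j.+1 :> nat ->
  exists s1 s2, index_enum 'I_N = s1 ++ [:: j, k & s2] /\
    {in s1 ++ s2, forall l, (l != j) && (l != k)}.
Proof.
move=> kE; have := index_enum_uniq 'I_N.
have lt_jN : (j < size (index_enum 'I_N))%N by rewrite /index_enum -enumT size_enum_ord.
have lt_kN : (k < size (index_enum 'I_N))%N by rewrite /index_enum -enumT size_enum_ord.
have nthE (l : 'I_N) : nth j (index_enum 'I_N) l = l.
  by rewrite /index_enum -enumT; apply: nth_ord_enum.
rewrite -(cat_take_drop j (index_enum _)) (drop_nth j lt_jN) nthE -kE.
rewrite (drop_nth j lt_kN) nthE; set s1 := take _ _; set s2 := drop _ _ => uniq_e.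
exists s1, s2; split=> // l; move: uniq_e; rewrite uniq_catC /= inE !mem_cat.
rewrite !negb_or => /and3P[/and3P[_ js2 js1] /andP[ks2 ks1] _].
by case/orP => l_in; apply/andP; split; apply: contraTneq l_in => ->.
Qed.

(** Consecutive indices give neighbouring factors in the ordered product. The outer factors [L F]
    see only the other indices, so they are shared by the terms of [s] and [tperm j k * s]. *)
Lemma prod_adjacent N (j k : 'I_N) : k = j.+1 :> nat ->
  exists L : ('I_N -> R) -> R * R,
    (forall F, \prod_i F i = (L F).1 * (F j * F k) * (L F).2) /\
    (forall F G, (forall l, l != j -> l != k -> F l = G l) -> L F = L G).
Proof.
move=> /index_enum_split2[s1 [s2 [-> s12]]].
exists (fun F => (\prod_(l <- s1) F l, \prod_(l <- s2) F l)); split => [F|F G FG].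
  by rewrite big_cat !big_cons /= !mulrA.
by congr (_, _); apply: eq_big_seq => l ls; apply: FG;
  have /s12/andP[] : l \in s1 ++ s2 by rewrite mem_cat ls ?orbT.
Qed.

(** Adding the two determinants termwise yields a middle factor whose symmetry in the two rows is
    exactly the hypothesis, so the alternating sum falls into [I]. *)
Lemma cdet_xcol_adjacent N (G : 'M[R]_N) (j k : 'I_N) : k = j.+1 :> nat ->
    (forall a b, G a j * G b k - G b j * G a k ~ G b k * G a j - G a k * G b j) ->
  I (cdet G + cdet (xcol j k G)).
Proof.
move=> kE Gjk; have neq_jk : j != k by rewrite -val_eqE /= kE neq_ltn ltnSn.
rewrite !cdetE -big_split /=; under eq_bigr do rewrite -mulrDr.
apply: (alternating_sum_ideal neq_jk) => s.
have [L [LE eqL]] := prod_adjacent kE; rewrite !LE.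
have {eqL}eqLs F : (forall l, l != j -> l != k -> F l = G (s l) l) ->
  L F = (L (fun l => G (s l) l)) by apply: eqL.
rewrite [L (fun l => G (_ (_ * _)%g _) _)]eqLs => [|l jl kl]; last first.
  by rewrite permM tpermD // eq_sym.
rewrite ![L (fun l => xcol _ _ _ _ _)]eqLs => [|l jl kl|l jl kl]; last first.
- by rewrite mxE permM !tpermD // eq_sym.
- by rewrite mxE tpermD // eq_sym.
rewrite !mxE !permM !tpermL !tpermR -!mulrDl -!mulrDr -mulrBl -mulrBr.
apply/idealMr/idealMl; rewrite -opprB; apply/idealN.
by have := Gjk (s j) (s k); rewrite opprB addrACA -opprD.
Qed.

Lemma cdet_adjacent_ideal N (G : 'M[R]_N) (j k : 'I_N) : k = j.+1 :> nat ->
  (forall a b, G a j * G b k ~ G b j * G a k) -> I (cdet G).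
Proof.
move=> kE Gjk; have neq_jk : j != k by rewrite -val_eqE /= kE neq_ltn ltnSn.
rewrite cdetE; apply: (alternating_sum_ideal neq_jk) => s.
have [L [LE eqL]] := prod_adjacent kE; rewrite !LE.
rewrite (eqL _ (fun l => G (s l) l)) => [|l jl kl]; last first.
  by rewrite permM tpermD // eq_sym.
rewrite !permM !tpermL !tpermR -mulrBl -mulrBr.
by apply/idealMr/idealMl.
Qed.

(** Restricting to the columns before [q] gives a condition that survives any change of column [q]
    itself. *)
Definition right_quantum_cols N (q : nat) (G : 'M[R]_N) :=
  forall k l : 'I_N, (k < q)%N -> (l < q)%N -> forall a b,
    G b k * G a k ~ G a k * G b k /\
    G a k * G b l - G b k * G a l ~ G b l * G a k - G a l * G b k.

(** Induction on the gap between [k] and [q]: exchanging column [k] with the next one only changes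
    the sign modulo [I] and brings the proportional column closer to [q]. Once adjacent, commutation
    inside column [k] makes [G a k * G b k * x] symmetric in the rows. *)
Lemma cdet_dependent_ideal N (G : 'M[R]_N) (q k : 'I_N) x : (k < q)%N ->
    right_quantum_cols q G -> (forall a, G a q = G a k * x) ->
  I (cdet G).
Proof.
move=> lt_kq; have [d qE] : exists d, q = (k + d.+1)%N :> nat.
  by exists (q - k.+1)%N; rewrite addnS -addSn subnKC.
elim: d k G qE lt_kq => [|d IHd] k G qE lt_kq rqG Gqk.
  apply: (@cdet_adjacent_ideal _ _ k q); first by rewrite qE addn1.
  by move=> a b; rewrite !Gqk !mulrA -mulrBl; apply/idealMr;
    have [] := rqG k k lt_kq lt_kq b a.
have lt_k1N : (k.+1 < N)%N by rewrite (leq_ltn_trans lt_kq).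
pose k1 := Ordinal lt_k1N.
have lt_k1q : (k1 < q)%N by rewrite qE /= !addnS !ltnS leq_addr.
rewrite -(addrK (cdet (xcol k k1 G)) (cdet G)); apply: idealB.
  by apply: cdet_xcol_adjacent => // a b; have [] := rqG k k1 lt_kq lt_k1q a b.
apply: (IHd k1) => //= [|l1 l2 lt1 lt2 a b|a]; first by rewrite qE !addnS.
  by rewrite !mxE; apply: rqG; case: tpermP => // ->.
by rewrite !mxE tpermR tpermD // neq_ltn ?lt_kq ?lt_k1q.
Qed.

Definition set_col N (q : 'I_N) (u : 'I_N -> R) (G : 'M[R]_N) : 'M[R]_N :=
  \matrix_(i, j) if j == q then u i else G i j.

(** The coefficients on both sides of [u (s q)] do not depend on [u], so determinants differing only
    in column [q] can be compared term by term. *)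
Lemma cdet_set_col_linear N (q : 'I_N) (G : 'M[R]_N) :
  exists L : 'S_N -> R * R,
    forall u, cdet (set_col q u G) = \sum_s (L s).1 * u (s q) * (L s).2.
Proof.
have [s1 [s2 [enumE q1 q2]]] := index_enum_split q.
exists (fun s : 'S_N => ((-1) ^+ s * \prod_(j <- s1) G (s j) j, \prod_(j <- s2) G (s j) j)).
move=> u; rewrite cdetE; apply: eq_bigr => s _ /=.
rewrite enumE big_cat big_cons /= -!mulrA mxE eqxx; congr (_ * (_ * (_ * _)));
  by apply: eq_big_seq => j js; rewrite mxE ifN//; apply: contraTneq js => ->.
Qed.

(** By linearity in column [q], the difference is minus a sum of determinants whose column [q] is a
    right multiple of an earlier column. *)
Lemma cdet_sub_cols N (G : 'M[R]_N) (q : 'I_N) (J : finType) (f : J -> 'I_N) x :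
    (forall k, (f k < q)%N) -> right_quantum_cols q G ->
  cdet (set_col q (fun a => G a q - \sum_k G a (f k) * x k) G) ~ cdet G.
Proof.
move=> lt_fq rqG; have [L LE] := cdet_set_col_linear q G.
have GE : G = set_col q (G^~ q) G.
  by apply/matrixP => i j; rewrite mxE; case: eqP => // ->.
rewrite [X in _ ~ cdet X]GE !LE -sumrB.
under eq_bigr do rewrite -mulrBl -mulrBr addrC addKr mulrN mulNr mulr_sumr mulr_suml.
rewrite sumrN exchange_big /=; apply/idealN/ideal_sum => k _.
rewrite -(LE (fun a => G a (f k) * x k)).
apply: (@cdet_dependent_ideal _ _ q (f k) (x k)) => // [l1 l2 lt1 lt2 a b|a].
  by rewrite !mxE !ifN ?neq_ltn ?lt1 ?lt2//; apply: rqG.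
by rewrite !mxE eqxx ifN // neq_ltn lt_fq.
Qed.

(* Right multiplication by the unipotent matrix [[1, - X], [0, 1]] clears the
   upper right block. Doing it one column at a time, from the last one, keeps
   the columns to the left of the current one right-quantum. *)
Lemma cdet_schur n p (Aul : 'M[R]_n) Aur Adl (Adr : 'M[R]_p) (X : 'M[R]_(n, p)) :
    right_quantum_cols (n + p) (block_mx Aul Aur Adl Adr) -> Aul *m X = Aur ->
  cdet (block_mx Aul Aur Adl Adr) ~ cdet Aul * cdet (Adr - Adl *m X).
Proof.
set G := block_mx _ _ _ _ => rqG AX.
pose u b a := G a (rshift n b) - \sum_k G a (lshift p k) * X k b.
(* In [T t] the right-hand columns from [t] on are already cleared: [T p] is [G], and [T 0] is block
   lower triangular. *)
pose T t : 'M[R]_(n + p) := \matrix_(i, j) match fintype.split j with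
  | inl _ => G i j | inr b => if (t <= b)%N then u b i else G i j end.
have Tl t i k : T t i (lshift p k) = G i (lshift p k).
  by rewrite mxE (unsplitK (inl _)).
have Tr t i b : T t i (rshift n b) = if (t <= b)%N then u b i else G i (rshift n b).
  by rewrite mxE (unsplitK (inr _)).
have T0 : T 0%N = block_mx Aul 0 Adl (Adr - Adl *m X).
  apply/matrixP => i j; case: (split_ordP j) => b -> {j}.
    rewrite Tl; case: (split_ordP i) => a ->;
      by rewrite ?block_mxEul ?block_mxEdl.
  rewrite Tr leq0n /u; case: (split_ordP i) => a ->.
    rewrite !block_mxEur -AX !mxE -sumrB big1// => k _.
    by rewrite block_mxEul subrr.
  rewrite !block_mxEdr !mxE; congr (_ - _).
  by apply: eq_bigr => k _; rewrite block_mxEdl.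
have Tp : T p = G.
  apply/matrixP => i j; case: (split_ordP j) => b -> {j}; first by rewrite Tl.
  by rewrite Tr leqNgt ltn_ord.
rewrite -(cdet_lblock Aul Adl) -T0 -[X in cdet X ~ _]Tp.
suff TT t : (t <= p)%N -> cdet (T t) ~ cdet (T 0%N) by apply: TT.
elim: t => [|t IHt] lt_tp; first by rewrite subrr.
apply: congr_trans (IHt (ltnW lt_tp)); pose b := Ordinal lt_tp.
have -> : T t = set_col (rshift n b)
    (fun a => T t.+1 a (rshift n b) - \sum_k T t.+1 a (lshift p k) * X k b) (T t.+1).
  apply/matrixP => i j; rewrite [RHS]mxE; case: (split_ordP j) => c -> {j}.
    by rewrite eq_lrshift !Tl.
  rewrite eq_rshift !Tr -val_eqE /= ltnn; have [->|/negPf neq_cb] := eqVneq c b.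
    by rewrite eqxx leqnn /u; under [in RHS]eq_bigr do rewrite Tl.
  by rewrite -[t]/(val b) val_eqE neq_cb [in RHS]ltn_neqAle eq_sym val_eqE neq_cb.
rewrite -opprB; apply/idealN/cdet_sub_cols => [k|k l lt_k lt_l a c].
  by rewrite /= (leq_trans (ltn_ord k))// leq_addr.
(* The columns before the one being cleared are still those of [G], hence right-quantum. *)
have TG (i j : 'I_(n + p)) : (j < rshift n b)%N -> T t.+1 i j = G i j.
  case: (split_ordP j) => d ->; first by rewrite Tl.
  by rewrite Tr /= ltn_add2l => lt_dt; rewrite leqNgt ltnS ltnW.
rewrite !TG //; apply: rqG; exact: ltn_ord.
Qed.

End ModuloIdeal.

(** * Special values of the column determinant; constant terms and inverses of series *)

Lemma cdet_mx11 (R : nzRingType) (B : 'M[R]_1) : cdet B = B 0 0.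
Proof.
rewrite cdetE (big_pred1 1%g) => [|s]; last by apply/esym/eqP/permP => i; rewrite !ord1.
by rewrite odd_perm1 mul1r big_ord1 perm1.
Qed.

Lemma cdet_tr (K : comNzRingType) N (B : 'M[K]_N) : cdet B = \det B^T.
Proof.
rewrite cdetE; apply: eq_bigr => s _; congr (_ * _).
by apply: eq_bigr => i _; rewrite mxE.
Qed.

Lemma ncs_sumE (K : nzRingType) (X : eqType) (J : Type) (r : seq J) (P : pred J)
  (F : J -> ncseries K X) w : (\sum_(j <- r | P j) F j) w = \sum_(j <- r | P j) F j w.
Proof. exact: (big_morph (fun f : ncseries K X => f w)). Qed.

Lemma ncs_mul_nil (K : nzRingType) (X : eqType) (f g : ncseries K X) :
  (f * g) [::] = f [::] * g [::].
Proof. by rewrite ncs_mulE big_ord1. Qed.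

Lemma cdet_nil (K : nzRingType) (X : eqType) N (M : 'M[ncseries K X]_N) :
  cdet M [::] = cdet (map_mx (fun f : ncseries K X => f [::]) M).
Proof.
rewrite /cdet ncs_sumE; apply: eq_bigr => s _; rewrite ncs_mul_nil; congr (_ * _).
  by elim: (inv_num s) => // k IHk; rewrite !exprS ncs_mul_nil IHk.
rewrite (big_morph (fun f : ncseries K X => f [::]) (@ncs_mul_nil _ _) (id1 := 1))//.
by apply: eq_bigr => j _; rewrite mxE.
Qed.

(* A matrix of series is a series of matrices, so [ncs_unit1] applies to it. *)
Lemma ncs_mx_right_inverse (K : nzRingType) (X : eqType) N (M : 'M[ncseries K X]_N) :
    map_mx (fun f : ncseries K X => f [::]) M = 1%:M ->
  exists M', M *m M' = 1%:M.
Proof.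
(* Empty matrices are treated apart: square matrices form a nontrivial ring only in positive
   size. *)
case: N M => [|N] M M1; first by exists 0; apply/matrixP => -[].
pose F : ncseries 'M[K]_N.+1 X := fun w => map_mx (fun f : ncseries K X => f w) M.
pose M' : 'M[ncseries K X]_N.+1 := \matrix_(i, j) (fun w => F^-1 w i j).
exists M'; apply/matrixP => i j; apply/funext => w.
have F1 : F [::] = 1 by [].
have /(congr1 (fun f : ncseries 'M[K]_N.+1 X => f w i j)) := mulrV (ncs_unit1 F1).
rewrite ncs_mulE summxE mxE ncs_sumE => FE.
under eq_bigr do rewrite ncs_mulE.
rewrite exchange_big /=; transitivity (((1 : ncseries 'M[K]_N.+1 X) w) i j).
  rewrite -FE; apply: eq_bigr => k _; rewrite mxE.
  by apply: eq_bigr => l _; rewrite !mxE.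
rewrite mxE ncs_oneE; transitivity ((i == j)%:R * (nilp w)%:R : K).
  by case: (nilp w); rewrite mxE ?mulr1 ?mulr0.
by case: (i == j); rewrite ?mul1r ?mul0r.
Qed.

(** * Right-quantum relations for [I - A] and its bordered submatrices *)

Lemma commutator_natB (R : nzRingType) (c d : nat) (x y : R) :
  (c%:R - x) * (d%:R - y) - (d%:R - y) * (c%:R - x) = x * y - y * x.
Proof.
have shift (e : nat) (u v : R) : (e%:R - u) * v - v * (e%:R - u) = v * u - u * v.
  by rewrite mulrBl mulrBr (commr_nat v) opprB addrC addrA subrK.
by rewrite !shift.
Qed.

(** Regrouped into commutators, the relations do not see the central constants [c]. The maps [rho]
    and [kappa] locate the entries of [G] in the generic matrix; injectivity keeps distinct indices
    distinct, as the relators require. *)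
Lemma right_quantum_generic (K : nzRingType) m (I : set (ncseries K ('I_m * 'I_m)%type))
    N q (G : 'M_N) (rho kappa : 'I_N -> 'I_m) :
    two_sided_ideal I -> (forall g, rq_relator g -> I g) ->
    injective rho -> injective kappa ->
    (forall a k, exists c : nat, G a k = c%:R - ncs_generic K m (rho a) (kappa k)) ->
  right_quantum_cols I q G.
Proof.
move=> [I0 IB _ _] genI rho_inj kappa_inj GE k l _ _ a b.
pose g a k := ncs_generic K m (rho a) (kappa k).
have comm a1 k1 a2 k2 : G a1 k1 * G a2 k2 - G a2 k2 * G a1 k1 =
    g a1 k1 * g a2 k2 - g a2 k2 * g a1 k1.
  by have [c ->] := GE a1 k1; have [d ->] := GE a2 k2; apply: commutator_natB.
have colI k1 a1 b1 : I (g b1 k1 * g a1 k1 - g a1 k1 * g b1 k1).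
  have [->|neq_ab] := eqVneq a1 b1; first by rewrite subrr.
  by apply/genI/RqColumn; rewrite (inj_eq rho_inj).
split; first by rewrite comm.
have subACA (w x y z : ncseries K ('I_m * 'I_m)%type) :
  (w - x) - (y - z) = (w - y) - (x - z).
  by rewrite !opprB addrACA [RHS]addrACA [- x - y]addrC.
rewrite subACA !comm.
(* For equal columns the cross relation is a difference of two column relations; for equal rows it
   is zero. *)
have [<-|neq_kl] := eqVneq k l; first exact: IB.
have [->|neq_ab] := eqVneq a b; first by rewrite subrr.
by rewrite subACA; apply/genI/RqCross; rewrite (inj_eq rho_inj, inj_eq kappa_inj).
Qed.

Theorem theorem6p3 (R : realType) (n p : nat) (hn : (1 <= n)%N) (hp : (1 <= p)%N) :
  let A : 'M[ncseries R[i] ('I_(n + p) * 'I_(n + p))%type]_(n + p) :=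
    ncs_generic R[i] (n + p) in
  rq_eq ((cdet (1%:M - ulsubmx A))^-1 * cdet (1%:M - A))
        (cdet (1%:M - schur_mx A)).
Proof.
move=> A I idI _ genI; have [I0 IB IMl IMr] := idI.
set A0 := 1%:M - ulsubmx A.
have A0_nil : map_mx (fun f : ncseries R[i] ('I_(n + p) * 'I_(n + p))%type => f [::])
    A0 = 1%:M.
  apply/matrixP => i j; rewrite !mxE /=.
  transitivity ((i == j)%:R - 0 : R[i]); last by rewrite subr0.
  by case: (i == j).
(* The constant term is the determinant of the identity, that is 1. *)
have A0_unit : cdet A0 \is a GRing.unit.
  by apply: ncs_unit1; rewrite cdet_nil A0_nil cdet_tr trmx1 det1.
have [Y A0Y] := ncs_mx_right_inverse A0_nil.
(* [X] clears the upper right block of [I - A], and its column [j] clears that of the bordered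
   matrices defining [C]. *)
pose X := - (Y *m ursubmx A).
have A0X : A0 *m X = - ursubmx A by rewrite mulmxN mulmxA A0Y mul1mx.
have AE : 1%:M - A = block_mx A0 (- ursubmx A) (- dlsubmx A) (1%:M - drsubmx A).
  rewrite -[A in LHS]submxK scalar_mx_block opp_block_mx add_block_mx !add0r.
  by [].
have IN x : I x -> I (- x) by move=> Ix; rewrite -sub0r; apply: IB.
have congr_trans y x z : I (x - y) -> I (y - z) -> I (x - z).
  by move=> xy /IN yz; rewrite -(subrK y x) -addrA -[y - z]opprK; apply: IB.
have divl x y z : x \is a GRing.unit -> I (y - x * z) -> I (x^-1 * y - z).
  by move=> x_unit /(IMl x^-1); rewrite mulrBr mulKr.
have rqA : right_quantum_cols I (n + p) (1%:M - A).
  apply: (@right_quantum_generic _ _ _ _ _ _ id id) => // a k.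
  by exists (a == k); rewrite !mxE.
(* The Schur formula with a 1 x 1 lower right block, multiplied on the left by [- (cdet A0)^-1]. *)
have schurE i j : I (schur_entry A i j - (drsubmx A i j - (dlsubmx A *m X) i j)).
  set B := block_mx A0 (- col j (ursubmx A)) (- row i (dlsubmx A))
                    (- (drsubmx A i j)%:M : 'M_1).
  (* The border index of the bordered matrix corresponds to index [rshift n q] of [A]. *)
  have inj_ext q : injective (fun a : 'I_(n + 1) =>
      match fintype.split a with inl b => lshift p b | inr _ => rshift n q end).
    move=> a b; case: (split_ordP a) => c ->; case: (split_ordP b) => d -> /eqP.
    - by rewrite eq_lshift => /eqP ->.
    - by rewrite eq_lrshift.
    - by rewrite eq_rlshift.
    - by rewrite !ord1.
  have rqB : right_quantum_cols I (n + 1) B.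
    apply: (right_quantum_generic _ _ (inj_ext i) (inj_ext j)) => // a k.
    rewrite /B; case: (split_ordP a) => c ->; case: (split_ordP k) => d ->.
    - by exists (c == d); rewrite block_mxEul !mxE.
    - by exists 0%N; rewrite block_mxEur !mxE sub0r.
    - by exists 0%N; rewrite block_mxEdl !mxE sub0r.
    - by exists 0%N; rewrite block_mxEdr !mxE sub0r !ord1 eqxx mulr1n.
  have A0Xj : A0 *m col j X = - col j (ursubmx A).
    by rewrite !colE mulmxA A0X mulNmx.
  have := cdet_schur I0 IB IMl IMr rqB A0Xj.
  rewrite cdet_mx11 => /(IMl (- (cdet A0)^-1)).
  rewrite mulrBr mulrA mulNr (mulNr _ (cdet A0)) mulVr // mulN1r.
  rewrite /schur_entry -/A0 -/B mulNr; congr (I (_ - _)).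
  rewrite !mxE eqxx mulr1n opprB addrC opprK.
  by congr (_ + _); rewrite -sumrN; apply: eq_bigr => k _; rewrite !mxE mulNr.
(* Entrywise, [1 - C] is congruent to the Schur complement of [1 - A]. *)
have SE i j : I ((1%:M - schur_mx A) i j - (1%:M - drsubmx A - (- dlsubmx A) *m X) i j).
  have /IN := schurE i j; congr (I _).
  rewrite mulNmx opprK; move: (_ *m _) => b; rewrite !mxE.
  rewrite !opprB opprD opprB addrA [in RHS](addrC (_ - schur_entry _ _ _)) addrA.
  by rewrite subrK addrAC.
have := @cdet_schur _ _ I0 IB IMl IMr _ _ A0 (- ursubmx A) (- dlsubmx A)
  (1%:M - drsubmx A) X.
rewrite -AE => /(_ rqA A0X)/(divl _ _ _ A0_unit) congr_schur.
apply: congr_trans congr_schur _.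
by rewrite -opprB; apply: IN; apply: cdet_congr.
Qed.
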